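(* Let $V=\mathbb{R}^7$, let $n$ be the norm related to a generic 3-form on $V$ and let $\mathcal{C}=\mathbb{R}1\oplus V$ be the corresponding octonion algebra. The group $\mathrm{Spin}(V,-n)$ acts transitively, via the spin representation, on $\{x\in\mathcal{C}\mid n(x)=1\}$. The isotropy subgroup $\{g\in\mathrm{Spin}(V,-n):g\cdot 1=1\}$ is isomorphic to $\mathrm{Aut}(\mathcal{C})$, the group of algebra automorphisms of $\mathcal{C}$.
   Context: A 3-form $\Omega$ on $V=\mathbb{R}^7$ is generic if its orbit under the natural action of $\mathrm{GL}_7(\mathbb{R})$ is open in $\wedge^3V^*$. The norm related to $\Omega$ is the nondegenerate quadratic form $n$ on $V$ (with polar form $n(X,Y)$, $n(X)=n(X,X)$) such that the multiplication $\times$ on $V$ defined by $n(X\times Y,Z)=\Omega(X,Y,Z)$ satisfies $n(X\times Y,X)=n(X\times Y,Y)=0$ and $n(X\times Y)=n(X)n(Y)-n(X,Y)^2$ for all $X,Y$; it is either positive definite or of signature $(4,3)$ (meaning 4 negative and 3 positive signs). On $\mathcal{C}=\mathbb{R}1\oplus V$ the product has unit $1$ and $XY:=-n(X,Y)1+X\times Y$ for $X,Y\in V$; the norm is extended by $n(1)=1$, $n(1,V)=0$. The Clifford algebra $\mathfrak{Cl}(V,-n)$ is the unital associative algebra generated by $V$ subject to $v^2=-n(v)1$, and $$\mathrm{Spin}(V,-n):=\Big\{\pm a_1\cdots a_{2r}: a_i\in V,\ \prod_{i=1}^{2r}n(a_i)=1\Big\}\subset\mathfrak{Cl}(V,-n).$$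 The spin representation of $\mathrm{Spin}(V,-n)$ on $\mathcal{C}$ is the restriction of the algebra homomorphism $\mathfrak{Cl}(V,-n)\to\mathrm{End}(\mathcal{C})$ extending $u\in V\mapsto L_u$, with $L_u(x)=ux$ (octonionic left multiplication); that is, $(\pm a_1\cdots a_{2r})\cdot x=\pm a_1(a_2(\cdots(a_{2r}x)\cdots))$. *)

(* Defs.v *)
From HB Require Import structures.
From mathcomp Require Import all_boot all_order all_algebra.
From mathcomp Require Import all_classical all_reals all_analysis.
From mathcomp Require Import ring.

Set Implicit Arguments.
Unset Strict Implicit.
Unset Printing Implicit Defensive.

Import Order.TTheory GRing.Theory Num.Theory.
Import numFieldNormedType.Exports.

Local Open Scope classical_set_scope.
Local Open Scope ring_scope.

(** [clifford q] is the unital associative R-algebra presented by the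
   generators [clifford_gen q v], which depend linearly on [v : V], and the
   relations [v ^ 2 = q v *: 1]: algebra expressions modulo the least algebra
   congruence containing these relations.  The ring structure is only a
   [pzRingType] because [1 = 0] may hold when [q] is an arbitrary function. *)

Section CliffordAlgebra.
Variables (R : comNzRingType) (V : lmodType R) (q : V -> R).

Inductive cl_term : Type :=
| ClGen of V
| ClZero
| ClOne
| ClAdd of cl_term & cl_term
| ClMul of cl_term & cl_term
| ClScale of R & cl_term.

HB.instance Definition _ := gen_eqMixin cl_term.
HB.instance Definition _ := gen_choiceMixin cl_term.

Inductive cl_cong : cl_term -> cl_term -> Prop :=
| cl_refl x : cl_cong x x
| cl_sym x y : cl_cong x y -> cl_cong y x
| cl_trans x y z : cl_cong x y -> cl_cong y z -> cl_cong x z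
| cl_congD x x' y y' :
    cl_cong x x' -> cl_cong y y' -> cl_cong (ClAdd x y) (ClAdd x' y')
| cl_congM x x' y y' :
    cl_cong x x' -> cl_cong y y' -> cl_cong (ClMul x y) (ClMul x' y')
| cl_congZ a x x' : cl_cong x x' -> cl_cong (ClScale a x) (ClScale a x')
| cl_addA x y z : cl_cong (ClAdd x (ClAdd y z)) (ClAdd (ClAdd x y) z)
| cl_addC x y : cl_cong (ClAdd x y) (ClAdd y x)
| cl_add0 x : cl_cong (ClAdd ClZero x) x
| cl_addN x : cl_cong (ClAdd (ClScale (- 1) x) x) ClZero
| cl_mulA x y z : cl_cong (ClMul x (ClMul y z)) (ClMul (ClMul x y) z)
| cl_mul1l x : cl_cong (ClMul ClOne x) x
| cl_mul1r x : cl_cong (ClMul x ClOne) x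
| cl_mulDl x y z :
    cl_cong (ClMul (ClAdd x y) z) (ClAdd (ClMul x z) (ClMul y z))
| cl_mulDr x y z :
    cl_cong (ClMul x (ClAdd y z)) (ClAdd (ClMul x y) (ClMul x z))
| cl_scaleA a b x : cl_cong (ClScale a (ClScale b x)) (ClScale (a * b) x)
| cl_scale1 x : cl_cong (ClScale 1 x) x
| cl_scaleDr a x y :
    cl_cong (ClScale a (ClAdd x y)) (ClAdd (ClScale a x) (ClScale a y))
| cl_scaleDl a b x :
    cl_cong (ClScale (a + b) x) (ClAdd (ClScale a x) (ClScale b x))
| cl_scaleAl a x y : cl_cong (ClScale a (ClMul x y)) (ClMul (ClScale a x) y)
| cl_scaleAr a x y : cl_cong (ClScale a (ClMul x y)) (ClMul x (ClScale a y))
| cl_gen_linear a v w :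
    cl_cong (ClGen (a *: v + w)) (ClAdd (ClScale a (ClGen v)) (ClGen w))
| cl_gen_sqr v : cl_cong (ClMul (ClGen v) (ClGen v)) (ClScale (q v) ClOne).

Definition cl_congb (x y : cl_term) : bool := `[< cl_cong x y >].

Lemma cl_congb_refl : reflexive cl_congb.
Proof. by move=> x; apply/asboolP; exact: cl_refl. Qed.

Lemma cl_congb_sym : symmetric cl_congb.
Proof. by move=> x y; apply/asboolP/asboolP; exact: cl_sym. Qed.

Lemma cl_congb_trans : transitive cl_congb.
Proof.
by move=> y x z /asboolP xy /asboolP yz; apply/asboolP; apply: cl_trans yz.
Qed.

Canonical cl_cong_equiv :=
  EquivRel cl_congb cl_congb_refl cl_congb_sym cl_congb_trans.

Local Open Scope quotient_scope.

Definition clifford := {eq_quot cl_cong_equiv}.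

HB.instance Definition _ := EqQuotient.on clifford.
HB.instance Definition _ := Choice.on clifford.

Let cl (x : cl_term) : clifford := \pi_clifford x.

Lemma cl_eqP (x y : cl_term) :
  \pi_clifford x = \pi_clifford y <-> cl_cong x y.
Proof. by split=> [/eqmodP/asboolP //|h]; apply/eqmodP/asboolP. Qed.

Lemma cl_reprP (x : cl_term) : cl_cong (repr (\pi_clifford x)) x.
Proof. by apply/cl_eqP; rewrite reprK. Qed.

Definition clifford_gen (v : V) : clifford := cl (ClGen v).
Definition clifford_zero : clifford := cl ClZero.
Definition clifford_one : clifford := cl ClOne.
Definition clifford_add (x y : clifford) : clifford :=
  cl (ClAdd (repr x) (repr y)).
Definition clifford_mul (x y : clifford) : clifford :=
  cl (ClMul (repr x) (repr y)).
Definition clifford_scale (a : R) (x : clifford) : clifford :=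
  cl (ClScale a (repr x)).
Definition clifford_opp (x : clifford) : clifford := clifford_scale (- 1) x.

Let addE x y : clifford_add (cl x) (cl y) = cl (ClAdd x y).
Proof. by apply/cl_eqP; apply: cl_congD; exact: cl_reprP. Qed.

Let mulE x y : clifford_mul (cl x) (cl y) = cl (ClMul x y).
Proof. by apply/cl_eqP; apply: cl_congM; exact: cl_reprP. Qed.

Let scaleE a x : clifford_scale a (cl x) = cl (ClScale a x).
Proof. by apply/cl_eqP; apply: cl_congZ; exact: cl_reprP. Qed.

Let clE := (addE, mulE, scaleE).

Let clP (x : clifford) : x = cl (repr x).
Proof. by rewrite /cl reprK. Qed.

Let addA : associative clifford_add.
Proof.
move=> x y z; rewrite (clP x) (clP y) (clP z) !clE.
by apply/cl_eqP; exact: cl_addA.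
Qed.

Let addC : commutative clifford_add.
Proof.
by move=> x y; rewrite (clP x) (clP y) !clE; apply/cl_eqP; exact: cl_addC.
Qed.

Let add0 : left_id clifford_zero clifford_add.
Proof. by move=> x; rewrite (clP x) !clE; apply/cl_eqP; exact: cl_add0. Qed.

Let addN : left_inverse clifford_zero clifford_opp clifford_add.
Proof.
by move=> x; rewrite /clifford_opp (clP x) !clE; apply/cl_eqP; exact: cl_addN.
Qed.

HB.instance Definition _ :=
  GRing.isZmodule.Build clifford addA addC add0 addN.

Let mulA : associative clifford_mul.
Proof.
move=> x y z; rewrite (clP x) (clP y) (clP z) !clE.
by apply/cl_eqP; exact: cl_mulA.
Qed.

Let mul1l : left_id clifford_one clifford_mul.
Proof. by move=> x; rewrite (clP x) !clE; apply/cl_eqP; exact: cl_mul1l. Qed.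

Let mul1r : right_id clifford_one clifford_mul.
Proof. by move=> x; rewrite (clP x) !clE; apply/cl_eqP; exact: cl_mul1r. Qed.

Let mulDl : left_distributive clifford_mul clifford_add.
Proof.
move=> x y z; rewrite (clP x) (clP y) (clP z) !clE.
by apply/cl_eqP; exact: cl_mulDl.
Qed.

Let mulDr : right_distributive clifford_mul clifford_add.
Proof.
move=> x y z; rewrite (clP x) (clP y) (clP z) !clE.
by apply/cl_eqP; exact: cl_mulDr.
Qed.

HB.instance Definition _ := GRing.Zmodule_isPzRing.Build clifford
  mulA mul1l mul1r mulDl mulDr.

Let scaleA a b (x : clifford) :
  clifford_scale a (clifford_scale b x) = clifford_scale (a * b) x.
Proof. by rewrite (clP x) !clE; apply/cl_eqP; exact: cl_scaleA. Qed.

Let scale1 : left_id 1 clifford_scale.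
Proof. by move=> x; rewrite (clP x) !clE; apply/cl_eqP; exact: cl_scale1. Qed.

Let scaleDr : right_distributive clifford_scale clifford_add.
Proof.
move=> a x y; rewrite (clP x) (clP y) !clE.
by apply/cl_eqP; exact: cl_scaleDr.
Qed.

Let scaleDl (x : clifford) : {morph clifford_scale^~ x : a b / a + b}.
Proof.
move=> a b; rewrite (clP x) !clE; change (cl (ClScale (a + b) (repr x)) =
  clifford_add (cl (ClScale a (repr x))) (cl (ClScale b (repr x)))).
by rewrite !clE; apply/cl_eqP; exact: cl_scaleDl.
Qed.

HB.instance Definition _ := GRing.Zmodule_isLmodule.Build R clifford
  scaleA scale1 scaleDr scaleDl.

Lemma clifford_scaleAl (a : R) (x y : clifford) :
  a *: (x * y) = (a *: x) * y.
Proof.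
change (clifford_scale a (clifford_mul x y) =
        clifford_mul (clifford_scale a x) y).
by rewrite (clP x) (clP y) !clE; apply/cl_eqP; exact: cl_scaleAl.
Qed.

Lemma clifford_scaleAr (a : R) (x y : clifford) :
  a *: (x * y) = x * (a *: y).
Proof.
change (clifford_scale a (clifford_mul x y) =
        clifford_mul x (clifford_scale a y)).
by rewrite (clP x) (clP y) !clE; apply/cl_eqP; exact: cl_scaleAr.
Qed.

Lemma clifford_gen_is_linear : linear clifford_gen.
Proof.
move=> a v w; change (cl (ClGen (a *: v + w)) =
  clifford_add (clifford_scale a (cl (ClGen v))) (cl (ClGen w))).
by rewrite !clE; apply/cl_eqP; exact: cl_gen_linear.
Qed.

HB.instance Definition _ := GRing.isLinear.Build R V clifford _ clifford_gen
  clifford_gen_is_linear.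

Lemma clifford_gen_sqr (v : V) : 
  clifford_gen v * clifford_gen v = q v *: (1 : clifford).
Proof.
change (clifford_mul (cl (ClGen v)) (cl (ClGen v)) =
        clifford_scale (q v) (cl ClOne)).
by rewrite !clE; apply/cl_eqP; exact: cl_gen_sqr.
Qed.

(** The extension of a linear map [f : V -> 'End(W)] satisfying
    [f v \o f v = q v *: \1] to an algebra morphism [clifford -> 'End(W)],
    the product of ['End(W)] being the composition. *)

Section Lift.
Variables (W : vectType R) (f : V -> 'End(W)).

Fixpoint cl_eval (x : cl_term) : 'End(W) :=
  match x with
  | ClGen v => f v
  | ClZero => 0
  | ClOne => \1%VF
  | ClAdd x y => cl_eval x + cl_eval y
  | ClMul x y => (cl_eval x \o cl_eval y)%VF
  | ClScale a x => a *: cl_eval x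
  end.

Definition clifford_lift (x : clifford) : 'End(W) := cl_eval (repr x).

Hypothesis f_linear : linear f.
Hypothesis f_sqr : forall v, (f v \o f v)%VF = q v *: \1%VF.

Lemma cl_eval_cong x y : cl_cong x y -> cl_eval x = cl_eval y.
Proof.
elim=> //=.
- by move=> {}x {}y z _ -> _ ->.
- by move=> {}x x' {}y y' _ -> _ ->.
- by move=> {}x x' {}y y' _ -> _ ->.
- by move=> a {}x x' _ ->.
- by move=> *; rewrite addrA.
- by move=> *; rewrite addrC.
- by move=> *; rewrite add0r.
- by move=> *; rewrite scaleN1r addNr.
- by move=> *; rewrite comp_lfunA.
- by move=> *; rewrite comp_lfun1l.
- by move=> *; rewrite comp_lfun1r.
- by move=> *; rewrite comp_lfunDl.
- by move=> *; rewrite comp_lfunDr.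
- by move=> *; rewrite scalerA.
- by move=> *; rewrite scale1r.
- by move=> *; rewrite scalerDr.
- by move=> *; rewrite scalerDl.
- by move=> *; rewrite comp_lfunZl.
- by move=> *; rewrite comp_lfunZr.
Qed.

Let liftE x : clifford_lift (cl x) = cl_eval x.
Proof. exact/cl_eval_cong/cl_reprP. Qed.

Lemma clifford_lift_gen v : clifford_lift (clifford_gen v) = f v.
Proof. exact: liftE. Qed.

Lemma clifford_lift1 : clifford_lift 1 = \1%VF.
Proof. exact: liftE. Qed.

Lemma clifford_liftM x y :
  clifford_lift (x * y) = (clifford_lift x \o clifford_lift y)%VF.
Proof. by rewrite (clP x) (clP y) [_ * _]mulE !liftE. Qed.

Lemma clifford_lift_is_linear : linear clifford_lift.
Proof.
move=> a x y; rewrite (clP x) (clP y).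
change (clifford_lift (clifford_add (clifford_scale a (cl (repr x)))
  (cl (repr y))) = a *: clifford_lift (cl (repr x)) + clifford_lift (cl (repr y))).
by rewrite !clE !liftE.
Qed.

End Lift.

End CliffordAlgebra.

(** [w] is the 3-form, [n] a quadratic form, and the octonions are the pairs
    in [R^o * V]. *)
Section Octonions.
Variable R : realType.
Local Notation V := 'cV[R]_7.
Implicit Types (w : V -> V -> V -> R) (n : V -> R).

Definition three_form w : Prop :=
  [/\ forall Y Z, scalar (fun X => w X Y Z),
      forall X Z, scalar (fun Y => w X Y Z),
      forall X Y, scalar (fun Z => w X Y Z)
    & forall X Y, [/\ w X X Y = 0, w X Y X = 0 & w Y X X = 0]].

Definition gl_act (g : 'M[R]_7) w : V -> V -> V -> R :=
  fun X Y Z => w (invmx g *m X) (invmx g *m Y) (invmx g *m Z).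

Definition gl_orbit w : set (V -> V -> V -> R) :=
  [set gl_act g w | g in [set g : 'M[R]_7 | g \in unitmx]].

(** The vector space of 3-forms is finite-dimensional, so its usual topology
    is the one induced by pointwise convergence of functions. *)
Definition open_in_three_forms (A : set (V -> V -> V -> R)) : Prop :=
  exists2 U : set {ptws V -> {ptws V -> {ptws V -> R}}},
    open U & A = U `&` three_form.

Definition generic w : Prop :=
  three_form w /\ open_in_three_forms (gl_orbit w).

Definition polar n (X Y : V) : R := 2^-1 * (n (X + Y) - n X - n Y).

Definition quadratic_form n : Prop :=
  (forall Y, scalar (polar n ^~ Y)) /\ (forall X, n X = polar n X X).

Definition nondegenerate_form n : Prop :=
  forall X, (forall Y, polar n X Y = 0) -> X = 0.

(** The vector [X x Y] such that [n(X x Y, Z) = w(X, Y, Z)] for all [Z]; it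
    exists and is unique when [n] is nondegenerate, see [crossP]. *)
Definition cross n w (X Y : V) : V :=
  xget 0 [set W | forall Z, polar n W Z = w X Y Z].

Definition related_norm w n : Prop :=
  [/\ quadratic_form n, nondegenerate_form n,
      forall X Y, polar n (cross n w X Y) X = 0 /\
                  polar n (cross n w X Y) Y = 0
    & forall X Y, n (cross n w X Y) = n X * n Y - polar n X Y ^+ 2].

Local Notation oct := (R^o * V)%type.

Definition oct_one : oct := (1, 0).

Definition oct_mul n w (x y : oct) : oct :=
  (x.1 * y.1 - polar n x.2 y.2,
   x.1 *: y.2 + y.1 *: x.2 + cross n w x.2 y.2).

Definition oct_norm n (x : oct) : R := x.1 ^+ 2 + n x.2.

Lemma oct_ext (x y : oct) : x.1 = y.1 -> x.2 = y.2 -> x = y.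
Proof. by case: x y => [x X] [y Y] /= -> ->. Qed.

Lemma polarC n X Y : polar n X Y = polar n Y X.
Proof. by rewrite /polar (addrC X) addrAC. Qed.

Lemma scalar_coord (f : V -> R) : scalar f ->
  forall Z, f Z = ((\row_j f (delta_mx j 0)) *m Z) 0 0.
Proof.
move=> fl Z.
pose f' : {scalar V} := HB.pack f (GRing.isLinear.Build R V R _ f fl).
rewrite -[f Z]/(f' Z) [in LHS](matrix_sum_delta Z) linear_sum mxE.
apply: eq_bigr => i _; rewrite big_ord_recl big_ord0 addr0 mxE.
by rewrite linearZ /= mulrC.
Qed.

Section Polar.
Variable n : V -> R.
Hypothesis nQ : quadratic_form n.
Hypothesis nN : nondegenerate_form n.

Lemma polar_linear_r X : scalar (polar n X).
Proof. by move=> a Y Z; rewrite ![polar n X _]polarC nQ.1. Qed.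

Lemma polarDr X Y Z : polar n X (Y + Z) = polar n X Y + polar n X Z.
Proof. by have := polar_linear_r X 1 Y Z; rewrite scale1r mul1r. Qed.

Lemma polar0r X : polar n X 0 = 0.
Proof.
by have := polar_linear_r X (-1) 0 0; rewrite scaler0 addr0 mulN1r addNr.
Qed.

Lemma polarZr X a Y : polar n X (a *: Y) = a * polar n X Y.
Proof. by have := polar_linear_r X a Y 0; rewrite polar0r !addr0. Qed.

Lemma polarDl X Y Z : polar n (Y + Z) X = polar n Y X + polar n Z X.
Proof. by rewrite polarC polarDr !(polarC n X). Qed.

Lemma polarZl X a Y : polar n (a *: Y) X = a * polar n Y X.
Proof. by rewrite polarC polarZr (polarC n X). Qed.

Lemma polar_inj X Y : (forall Z, polar n X Z = polar n Y Z) -> X = Y.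
Proof.
move=> XY; apply/subr0_eq/nN => Z.
by rewrite -scaleN1r polarDl polarZl XY mulN1r subrr.
Qed.

Lemma polar_repr (f : V -> R) : scalar f ->
  exists W, forall Z, polar n W Z = f Z.
Proof.
move=> fl; pose G : 'M[R]_7 := \matrix_(i, j) polar n (delta_mx i 0) (delta_mx j 0).
have polE W Z : polar n W Z = (W^T *m G *m Z) 0 0.
  rewrite (scalar_coord (polar_linear_r W)); congr ((_ *m Z) 0 0).
  apply/rowP => j; rewrite mxE (scalar_coord (nQ.1 (delta_mx j 0))).
  rewrite [LHS]mxE [RHS]mxE; apply: eq_bigr => k _.
  by rewrite !mxE mulrC.
have Gu : G \in unitmx.
  rewrite -row_free_unit -kermx_eq0; apply/eqP/row_matrixP => i; rewrite row0.
  have kG : row i (kermx G) *m G = 0.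
    by rewrite -row_mul mulmx_ker row0.
  apply: trmx_inj; rewrite trmx0; apply: nN => Z.
  by rewrite polE trmxK kG mul0mx mxE.
exists ((\row_j f (delta_mx j 0)) *m invmx G)^T => Z.
by rewrite polE trmxK mulmxKV // [RHS](scalar_coord fl).
Qed.

End Polar.

Lemma crossP w n : three_form w -> quadratic_form n -> nondegenerate_form n ->
  forall X Y Z, polar n (cross n w X Y) Z = w X Y Z.
Proof.
move=> [_ _ w3 _] nQ nN X Y; rewrite /cross.
by case: xgetP => [W _ // | noW]; case: (polar_repr nQ nN (w3 X Y)) => W /noW.
Qed.

Definition spin n : set (clifford (fun v => - n v)) :=
  [set g | exists r (a : seq V),
    [/\ size a = (2 * r)%N, \prod_(v <- a) n v = 1
      & let p := \prod_(v <- a) clifford_gen (fun v => - n v) v in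
        g = p \/ g = - p]].

Arguments spin : clear implicits.

Definition oct_lmul n w (u : V) : 'End(oct) := linfun (oct_mul n w (0, u)).

(** By [spin_rep_gen], [spin_rep1], [spin_repM] and [spin_rep_is_linear] this
    is the algebra morphism extending [oct_lmul]. *)
Definition spin_rep n w : clifford (fun v => - n v) -> 'End(oct) :=
  clifford_lift (oct_lmul n w).

Section SpinRepresentation.
Variables (w : V -> V -> V -> R) (n : V -> R).
Hypothesis wG : generic w.
Hypothesis nw : related_norm w n.

Let w3 : three_form w := wG.1.
Let nQ : quadratic_form n. Proof. by case: nw. Qed.
Let nN : nondegenerate_form n. Proof. by case: nw. Qed.
Let crossE X Y Z : polar n (cross n w X Y) Z = w X Y Z.
Proof. exact: crossP. Qed.

Lemma cross_linear_r X : linear (cross n w X).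
Proof.
move=> a Y Y'; apply: (polar_inj nQ nN) => Z.
by rewrite polarDl // polarZl // !crossE; case: w3 => _ -> _ _.
Qed.

Lemma cross_linear_l Y : linear (cross n w ^~ Y).
Proof.
move=> a X X'; apply: (polar_inj nQ nN) => Z.
by rewrite polarDl // polarZl // !crossE; case: w3 => -> _ _ _.
Qed.

Lemma oct_mul_linear_r x : linear (oct_mul n w x).
Proof.
case: x => x X a [y Y] [z Z]; apply: oct_ext.
  change (x * (a * y + z) - polar n X (a *: Y + Z) =
    a * (x * y - polar n X Y) + (x * z - polar n X Z)).
  by rewrite polarDr // polarZr //; ring.
change (x *: (a *: Y + Z) + (a * y + z) *: X + cross n w X (a *: Y + Z) =
  a *: (x *: Y + y *: X + cross n w X Y) + (x *: Z + z *: X + cross n w X Z)).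
by rewrite cross_linear_r; apply/colP => i; rewrite !mxE; ring.
Qed.

Lemma oct_mul_linear_l y : linear (oct_mul n w ^~ y).
Proof.
case: y => y Y a [x X] [z Z]; apply: oct_ext.
  change ((a * x + z) * y - polar n (a *: X + Z) Y =
    a * (x * y - polar n X Y) + (z * y - polar n Z Y)).
  by rewrite polarDl // polarZl //; ring.
change ((a * x + z) *: Y + y *: (a *: X + Z) + cross n w (a *: X + Z) Y =
  a *: (x *: Y + y *: X + cross n w X Y) + (z *: Y + y *: Z + cross n w Z Y)).
by rewrite cross_linear_l; apply/colP => i; rewrite !mxE; ring.
Qed.

Lemma cross_cross X Y :
  cross n w X (cross n w X Y) = polar n X Y *: X - n X *: Y.
Proof.
have wC A B C : w A B C = - w A C B.
  case: w3 => _ l2 l3 alt; have [_ _ /eqP] := alt (B + C) A.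
  have D2 D E F : w A (D + E) F = w A D F + w A E F.
    by have := l2 A F 1 D E; rewrite scale1r mul1r.
  have D3 D E F : w A D (E + F) = w A D E + w A D F.
    by have := l3 A D 1 E F; rewrite scale1r mul1r.
  have [[_ _ B0] [_ _ C0]] := (alt B A, alt C A).
  by rewrite D2 !D3 B0 C0 add0r addr0 addr_eq0 => /eqP.
have crossDr A B C : cross n w A (B + C) = cross n w A B + cross n w A C.
  by have := cross_linear_r A 1 B C; rewrite !scale1r.
apply: (polar_inj nQ nN) => Z.
have -> : polar n (polar n X Y *: X - n X *: Y) Z =
    polar n X Y * polar n X Z - n X * polar n Z Y.
  by rewrite polarDl // -scaleNr !polarZl // mulNr (polarC n Y).
rewrite crossE wC -crossE; case: nw => _ _ _ ncross.
have polE A B : polar n A B = 2^-1 * (n (A + B) - n A - n B) by [].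
rewrite [X in - X]polE -crossDr !ncross polarDr // (polE Z Y).
by field.
Qed.

Lemma oct_lmulE u x : oct_lmul n w u x = oct_mul n w (0, u) x.
Proof.
pose f : {linear oct -> oct} :=
  HB.pack (oct_mul n w (0, u)) (GRing.isLinear.Build R oct oct _ _
    (oct_mul_linear_r (0, u))).
exact: (lfunE f).
Qed.

Lemma oct_lmul_is_linear : linear (oct_lmul n w).
Proof.
move=> a u v; apply/lfunP => x; rewrite add_lfunE scale_lfunE !oct_lmulE.
rewrite -oct_mul_linear_l; congr (oct_mul n w _ x).
by apply: oct_ext; rewrite //= scaler0 addr0.
Qed.

Lemma oct_lmul_sqr u : (oct_lmul n w u \o oct_lmul n w u)%VF = (- n u) *: \1%VF.
Proof.
apply/lfunP => -[y Y]; rewrite comp_lfunE scale_lfunE id_lfunE !oct_lmulE.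
have crossuu : cross n w u u = 0.
  apply: (polar_inj nQ nN) => Z; rewrite crossE.
  by case: w3 => _ _ _ /(_ u Z) [-> _ _]; rewrite polarC (polar0r nQ).
have pcr : polar n u (cross n w u Y) = 0.
  by case: nw => _ _ /(_ u Y) [+ _] _; rewrite polarC.
apply: oct_ext.
  change (0 * (0 * y - polar n u Y) -
    polar n u (0 *: Y + y *: u + cross n w u Y) = - n u * y).
  by rewrite scale0r add0r polarDr // polarZr // pcr -nQ.2; ring.
change (0 *: (0 *: Y + y *: u + cross n w u Y) + (0 * y - polar n u Y) *: u +
  cross n w u (0 *: Y + y *: u + cross n w u Y) = (- n u) *: Y).
rewrite !scale0r !add0r cross_linear_r crossuu scaler0 add0r cross_cross.
by apply/colP => i; rewrite !mxE; ring.
Qed.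

Lemma spin_rep_gen u :
  spin_rep w (clifford_gen (fun v => - n v) u) = oct_lmul n w u.
Proof.
by apply: clifford_lift_gen; [exact: oct_lmul_is_linear|exact: oct_lmul_sqr].
Qed.

Lemma spin_rep1 : spin_rep w (1 : clifford (fun v => - n v)) = \1%VF.
Proof.
by apply: clifford_lift1; [exact: oct_lmul_is_linear|exact: oct_lmul_sqr].
Qed.

Lemma spin_repM (x y : clifford (fun v => - n v)) :
  spin_rep w (x * y) = (spin_rep w x \o spin_rep w y)%VF.
Proof.
by apply: clifford_liftM; [exact: oct_lmul_is_linear|exact: oct_lmul_sqr].
Qed.

Lemma spin_rep_is_linear :
  linear (spin_rep w : clifford (fun v => - n v) -> 'End(oct)).
Proof.
by apply: clifford_lift_is_linear;
  [exact: oct_lmul_is_linear|exact: oct_lmul_sqr].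
Qed.

End SpinRepresentation.

Section SpinGroup.
Variable n : V -> R.
Local Notation q := (fun v => - n v).
Local Notation gens a := (\prod_(v <- a) clifford_gen q v).

Lemma spin1 : spin n 1.
Proof. by exists 0, [::]; split; rewrite ?big_nil //; left. Qed.

Lemma spinM g h : spin n g -> spin n h -> spin n (g * h).
Proof.
move=> [r [a [sa pa ga]]] [s [b [sb pb hb]]]; exists (r + s)%N, (a ++ b).
split; first by rewrite size_cat sa sb mulnDr.
  by rewrite big_cat /= pa pb mul1r.
rewrite /= big_cat /=; case: ga hb => -> [] ->; rewrite ?mulNr ?mulrN ?opprK.
- by left.
- by right.
- by right.
- by left.
Qed.

Lemma gens_rev a :
  gens a * gens (rev a) = (\prod_(v <- a) - n v) *: (1 : clifford q).
Proof.
elim: a => [|v a IH]; first by rewrite !big_nil mul1r scale1r.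
rewrite rev_cons -cats1 !big_cons big_cat big_seq1 /= mulrA -(mulrA _ (gens a)).
rewrite IH -clifford_scaleAr mulr1 -clifford_scaleAl clifford_gen_sqr scalerA.
by rewrite mulrC.
Qed.

Lemma spinV g : spin n g -> exists h, [/\ spin n h, h * g = 1 & g * h = 1].
Proof.
move=> [r [a [sa pa ga]]].
have prodN b : size b = (2 * r)%N -> \prod_(v <- b) n v = 1 ->
    \prod_(v <- b) - n v = 1.
  move=> sb pb; have -> : \prod_(v <- b) - n v =
      (-1) ^+ size b * \prod_(v <- b) n v.
    elim: (b) => [|v c IH]; first by rewrite !big_nil mul1r.
    by rewrite !big_cons IH /= exprS; ring.
  by rewrite sb pb exprM sqrrN expr1n mulr1 expr1n.
have sra : size (rev a) = (2 * r)%N by rewrite size_rev.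
have pra : \prod_(v <- rev a) n v = 1.
  by rewrite -[RHS]pa; apply: perm_big; rewrite perm_rev.
have aV : gens a * gens (rev a) = 1 by rewrite gens_rev prodN ?scale1r.
have Va : gens (rev a) * gens a = 1.
  by rewrite -[X in _ * gens X]revK gens_rev prodN ?scale1r.
case: ga => /= ->.
  by exists (gens (rev a)); split=> //; exists r, (rev a); split=> //; left.
exists (- gens (rev a)); split; rewrite ?mulrNN //.
by exists r, (rev a); split=> //; right.
Qed.

Definition spin_group : Type := {g : clifford q | `[< spin n g >]}.

HB.instance Definition _ := SubChoice.on spin_group.

Let spinP (g : spin_group) : spin n (val g).
Proof. exact/asboolP/(valP g). Qed.

Definition spin_group_one : spin_group := Sub 1 (asboolT spin1).

Definition spin_group_mul (g h : spin_group) : spin_group :=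
  Sub (val g * val h) (asboolT (spinM (spinP g) (spinP h))).

Definition spin_group_inv (g : spin_group) : spin_group :=
  xget spin_group_one
    [set h | spin_group_mul h g = spin_group_one /\
             spin_group_mul g h = spin_group_one].

Let spin_group_invP g :
  spin_group_mul (spin_group_inv g) g = spin_group_one /\
  spin_group_mul g (spin_group_inv g) = spin_group_one.
Proof.
rewrite /spin_group_inv; case: xgetP => [//|noV].
have [h [hS hg gh]] := spinV (spinP g).
by case: (noV (Sub h (asboolT hS))); split; apply: val_inj; rewrite /= ?SubK.
Qed.

Let spin_mulA : associative spin_group_mul.
Proof. by move=> x y z; apply: val_inj; rewrite /= mulrA. Qed.

Let spin_mul1g : left_id spin_group_one spin_group_mul.
Proof. by move=> x; apply: val_inj; rewrite /= mul1r. Qed.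

Let spin_mulg1 : right_id spin_group_one spin_group_mul.
Proof. by move=> x; apply: val_inj; rewrite /= mulr1. Qed.

Let spin_mulVg : left_inverse spin_group_one spin_group_inv spin_group_mul.
Proof. by move=> x; case: (spin_group_invP x). Qed.

Let spin_mulgV : right_inverse spin_group_one spin_group_inv spin_group_mul.
Proof. by move=> x; case: (spin_group_invP x). Qed.

HB.instance Definition _ := isGroup.Build spin_group
  spin_mulA spin_mul1g spin_mulg1 spin_mulVg spin_mulgV.

End SpinGroup.

Definition spin_act n w (g : spin_group n) (x : oct) : oct :=
  spin_rep w (val g) x.

(** The isotropy subgroup of [1]; the proofs of [generic w] and of
    [related_norm w n] are needed only for it to be a group. *)
Section Isotropy.
Variables (w : V -> V -> V -> R) (n : V -> R).
Hypotheses (wG : generic w) (nw : related_norm w n).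

Definition fixes_one : pred (spin_group n) :=
  fun g => spin_act w g oct_one == oct_one.

Lemma spin_act1 x : spin_act w (1%g : spin_group n) x = x.
Proof. by rewrite /spin_act (spin_rep1 wG nw) id_lfunE. Qed.

Lemma spin_actM (g h : spin_group n) x :
  spin_act w (g * h)%g x = spin_act w g (spin_act w h x).
Proof. by rewrite /spin_act (spin_repM wG nw) comp_lfunE. Qed.

Lemma fixes_one_group_closed : group_closed fixes_one.
Proof.
split; first by apply/eqP; exact: spin_act1.
move=> g h /eqP g1 /eqP h1; apply/eqP.
have hV : spin_act w (h^-1)%g oct_one = oct_one.
  by rewrite -[in LHS]h1 -spin_actM mulVg spin_act1.
by rewrite spin_actM hV.
Qed.

Definition isotropy of generic w & related_norm w n : Type :=
  {g : spin_group n | fixes_one g}.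

HB.instance Definition _ := SubChoice.on (isotropy wG nw).
HB.instance Definition _ := SubChoice_isSubGroup.Build (spin_group n) fixes_one
  (isotropy wG nw) fixes_one_group_closed.

End Isotropy.

Section Automorphisms.
Variables (n : V -> R) (w : V -> V -> V -> R).

(** Linearity is part of the type ['End(oct)]. *)
Definition oct_automorphism (f : 'End(oct)) : Prop :=
  bijective f /\ forall x y, f (oct_mul n w x y) = oct_mul n w (f x) (f y).

Lemma oct_automorphism1 : oct_automorphism \1%VF.
Proof. by split=> [|x y]; [exists id => x|]; rewrite !id_lfunE. Qed.

Lemma oct_automorphismM f g : oct_automorphism f -> oct_automorphism g ->
  oct_automorphism (f \o g)%VF.
Proof.
move=> [bf fM] [bg gM]; split=> [|x y]; last by rewrite !comp_lfunE gM fM.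
by apply: (eq_bij (bij_comp bf bg)) => x; rewrite comp_lfunE.
Qed.

Let lfun_bijK (f : 'End(oct)) : bijective f ->
  cancel f (f^-1)%VF /\ cancel (f^-1)%VF f.
Proof.
move=> bf; have fK : cancel f (f^-1)%VF by apply/lker0_lfunK/lker0P/bij_inj.
by split=> //; apply/(bij_can_sym bf).
Qed.

Lemma oct_automorphismV f : oct_automorphism f -> oct_automorphism (f^-1)%VF.
Proof.
move=> [bf fM]; have [fK Kf] := lfun_bijK bf; split; first by exists f.
by move=> x y; apply: (can_inj fK); rewrite /= Kf fM !Kf.
Qed.

Definition oct_aut : Type := {f : 'End(oct) | `[< oct_automorphism f >]}.

HB.instance Definition _ := SubChoice.on oct_aut.

Let autP (f : oct_aut) : oct_automorphism (val f).
Proof. exact/asboolP/(valP f). Qed.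

Definition oct_aut_one : oct_aut := Sub \1%VF (asboolT oct_automorphism1).

Definition oct_aut_mul (f g : oct_aut) : oct_aut :=
  Sub (val f \o val g)%VF (asboolT (oct_automorphismM (autP f) (autP g))).

Definition oct_aut_inv (f : oct_aut) : oct_aut :=
  Sub ((val f)^-1)%VF (asboolT (oct_automorphismV (autP f))).

Let aut_mulA : associative oct_aut_mul.
Proof. by move=> x y z; apply: val_inj; rewrite /= comp_lfunA. Qed.

Let aut_mul1g : left_id oct_aut_one oct_aut_mul.
Proof. by move=> x; apply: val_inj; rewrite /= comp_lfun1l. Qed.

Let aut_mulg1 : right_id oct_aut_one oct_aut_mul.
Proof. by move=> x; apply: val_inj; rewrite /= comp_lfun1r. Qed.

Let aut_mulVg : left_inverse oct_aut_one oct_aut_inv oct_aut_mul.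
Proof.
move=> f; apply/val_inj/lfunP => x; rewrite /= comp_lfunE id_lfunE.
by case: (lfun_bijK (autP f).1).
Qed.

Let aut_mulgV : right_inverse oct_aut_one oct_aut_inv oct_aut_mul.
Proof.
move=> f; apply/val_inj/lfunP => x; rewrite /= comp_lfunE id_lfunE.
by case: (lfun_bijK (autP f).1).
Qed.

HB.instance Definition _ := isGroup.Build oct_aut
  aut_mulA aut_mul1g aut_mulg1 aut_mulVg aut_mulgV.

End Automorphisms.

End Octonions.

Arguments spin {R} n.
Arguments oct_one {R}.

(* Main.v *)
(** Left multiplication by an imaginary octonion multiplies the norm by [n u],
    so Spin preserves the norm.  If [u] is a nonisotropic vector orthogonal to
    the imaginary part of [x], then [x = u (u^-1 x)] is a product of two imaginary
    octonions, whence transitivity.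

    In the Clifford algebra, [a v = - s_a(v) a] for the reflection [s_a].  So an
    even product [g] of vectors acts on [V] by a product [s] of reflections with
    [g (v x) = s(v) (g x)], and when [g 1 = 1] this says that [g] acts as an
    automorphism, equal to [s] on [V].  If this automorphism is trivial, [g] is
    central; averaging over conjugations by an orthogonal basis shows that an
    even central product of vectors is a scalar, so [g = 1].

    Conversely, given an automorphism [f], some even product [g] of vectors
    satisfies [s = f] on six vectors of an orthogonal basis.  The product of the
    left multiplications by all seven basis vectors is a nonzero scalar, because
    only scalars commute with all left multiplications.  Hence [f^-1 g] commutes
    with all left multiplications and is a scalar [c], and [c^2] is the product
    of the norms of the factors of [g], so that [g / c] lies in Spin. *)

Require Import Defs.
From HB Require Import structures.
From mathcomp Require Import all_boot all_order all_algebra.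
From mathcomp Require Import all_classical all_reals all_analysis.
From mathcomp Require Import ring lra.

Set Implicit Arguments.
Unset Strict Implicit.
Unset Printing Implicit Defensive.

Import GRing.Theory Num.Theory.

Local Open Scope ring_scope.

(** * Orthogonal complements and orthogonal bases for a nondegenerate form *)

Section QuadraticForm.
Variables (R : realType) (n : 'cV[R]_7 -> R).
Hypotheses (nQ : quadratic_form n) (nN : nondegenerate_form n).
Local Notation V := 'cV[R]_7.
Local Notation b := (polar n).

Lemma polar0l (X : V) : b 0 X = 0.
Proof. by rewrite polarC polar0r. Qed.

Lemma polarNr (X Y : V) : b X (- Y) = - b X Y.
Proof. by rewrite -scaleN1r polarZr // mulN1r. Qed.

Lemma polarNl (X Y : V) : b (- X) Y = - b X Y.
Proof. by rewrite polarC polarNr polarC. Qed.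

Definition polar_expand := (polarDl nQ, polarDr nQ, polarZl nQ, polarZr nQ,
  polarNl, polarNr, polar0l, polar0r nQ).

Lemma polar_sumr (I : Type) (r : seq I) (P : pred I) (F : I -> V) X :
  b X (\sum_(i <- r | P i) F i) = \sum_(i <- r | P i) b X (F i).
Proof.
by elim/big_rec2: _ => [|i y1 y2 _ <-]; rewrite ?polar0r // polarDr.
Qed.

Definition gram : 'M[R]_7 := \matrix_(i, j) b (delta_mx i 0) (delta_mx j 0).

Lemma polar_gram X Y : b X Y = (X^T *m gram *m Y) 0 0.
Proof.
rewrite (scalar_coord (polar_linear_r nQ X)); congr ((_ *m Y) 0 0).
apply/rowP => j; rewrite mxE (scalar_coord (nQ.1 (delta_mx j 0))).
rewrite [LHS]mxE [RHS]mxE; apply: eq_bigr => k _.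
by rewrite !mxE mulrC.
Qed.

Lemma gram_eq0 k (K : 'M[R]_(k, 7)) : K *m gram = 0 -> K = 0.
Proof.
move=> KG; apply/row_matrixP => i; rewrite row0.
apply: trmx_inj; rewrite trmx0; apply: nN => Z.
by rewrite polar_gram trmxK -row_mul KG row0 mul0mx mxE.
Qed.

Lemma gram_unit : gram \in unitmx.
Proof.
by rewrite -row_free_unit -kermx_eq0; apply/eqP/gram_eq0; rewrite mulmx_ker.
Qed.

Definition orth_mx (s : seq V) : 'M[R]_(7, size s) :=
  gram *m \matrix_(i, j) s`_j i 0.

Lemma orth_mxP (s : seq V) (u : 'rV[R]_7) :
  u *m orth_mx s = 0 <-> {in s, forall x, b u^T x = 0}.
Proof.
have E (j : 'I_(size s)) : (u *m orth_mx s) 0 j = b u^T s`_j.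
  rewrite polar_gram trmxK /orth_mx mulmxA !mxE.
  by apply: eq_bigr => k _; rewrite !mxE.
split=> [u0 x /(nthP 0)[i ilt <-]|uo].
  by rewrite -(E (Ordinal ilt)) u0 mxE.
by apply/rowP => j; rewrite E mxE uo // mem_nth.
Qed.

Lemma orth_ker_rank (s : seq V) : (7 - size s <= \rank (kermx (orth_mx s)))%N.
Proof. by rewrite mxrank_ker leq_sub2l // rank_leq_col. Qed.

Lemma exists_orth (s : seq V) : (size s < 7)%N ->
  exists2 u, u != 0 & {in s, forall x, b u x = 0}.
Proof.
move=> s7; have: kermx (orth_mx s) != 0.
  rewrite -mxrank_eq0 -lt0n; apply: leq_trans (orth_ker_rank s).
  by rewrite subn_gt0.
case/rowV0Pn => u /sub_kermxP /orth_mxP u0 uN0; exists u^T => //.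
by apply: contraNneq uN0 => u00; rewrite -[u]trmxK u00 trmx0.
Qed.

Lemma isotropic_polar0 (U : V -> Prop) :
  (forall X Y, U X -> U Y -> U (X + Y)) -> (forall X, U X -> n X = 0) ->
  forall X Y, U X -> U Y -> b X Y = 0.
Proof.
by move=> UD U0 X Y UX UY; rewrite /polar !U0 ?subr0 ?mulr0 //; apply: UD.
Qed.

(* A totally isotropic subspace has dimension at most 3, so it cannot be the
   orthogonal of fewer than 4 vectors. *)
Lemma exists_orth_nonisotropic (s : seq V) : (2 * size s < 7)%N ->
  exists2 u, n u != 0 & {in s, forall x, b u x = 0}.
Proof.
move=> s7; apply: contrapT => noU.
pose U (u : V) := {in s, forall x, b u x = 0}.
have UD X Y : U X -> U Y -> U (X + Y).
  by move=> UX UY x xs; rewrite polarDl // UX // UY // addr0.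
have U0 X : U X -> n X = 0.
  by move=> UX; apply/eqP; apply: contraPT UX => nX UX; apply: noU; exists X.
pose K := kermx (orth_mx s).
have KU i : U (row i K)^T.
  by apply/orth_mxP; rewrite -row_mul mulmx_ker row0.
have K0 : K *m gram *m K^T = 0.
  apply/matrixP => i j; have := isotropic_polar0 UD U0 (KU i) (KU j).
  rewrite polar_gram trmxK -row_mul mxE => KK; rewrite !mxE -[RHS]KK.
  by apply: eq_bigr => k _; rewrite !mxE.
(* The product [K0] gives [2 * \rank K <= 7], while [\rank K] is at least [7 - size s], which
   exceeds [7 / 2]. *)
have := mulmx0_rank_max K0.
rewrite mxrank_tr mxrankMfree ?row_free_unit ?gram_unit //.
rewrite -/K; apply/negP; rewrite -ltnNge.
apply: leq_trans (leq_add (orth_ker_rank s) (orth_ker_rank s)).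
by move: s7; rewrite mulnC; case: (size s) => [|[|[|[|m]]]].
Qed.

Definition orthobasis k (e : nat -> V) :=
  (forall i, (i < k)%N -> n (e i) != 0) /\
  (forall i j, (i < k)%N -> (j < k)%N -> i != j -> b (e i) (e j) = 0).

Lemma polar_orthobasis k e i (c : nat -> R) : orthobasis k e -> (i < k)%N ->
  b (e i) (\sum_(j < k) c j *: e j) = c i * n (e i).
Proof.
move=> [eN eO] ik; rewrite polar_sumr (bigD1 (Ordinal ik)) //= big1 => [|j ji].
  by rewrite addr0 polarZr // -nQ.2.
rewrite polarZr // eO ?mulr0 //; apply: contraNneq ji => ij.
by apply/eqP/val_inj; rewrite /= ij.
Qed.

(** A new vector is a nonisotropic one orthogonal to the previous ones. If none existed, that
    orthogonal would be totally isotropic; a nonzero [u] in it would be orthogonal to it and to all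
    [e i], hence to every [v], against nondegeneracy. *)
Lemma exists_orthobasis k : (k <= 7)%N -> exists e, orthobasis k e.
Proof.
elim: k => [|k IH] k7; first by exists (fun=> 0); split.
have {IH} [e eB] := IH (ltnW k7); have [eN eO] := eB.
pose U (u : V) := forall i, (i < k)%N -> b (e i) u = 0.
have [u uN uU] : exists2 u, n u != 0 & U u.
  apply: contrapT => noU.
  have UD X Y : U X -> U Y -> U (X + Y).
    by move=> UX UY i ik; rewrite polarDr // UX // UY // addr0.
  have U0 X : U X -> n X = 0.
    by move=> UX; apply/eqP; apply: contraPT UX => nX UX; apply: noU; exists X.
  have [|u /eqP uN0 u0] := @exists_orth (mkseq e k).
    by rewrite size_mkseq.
  have eu i : (i < k)%N -> b u (e i) = 0.
    by move=> ik; apply: u0; apply/mapP; exists i; rewrite ?mem_iota.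
  (* These are the coefficients of the orthogonal projection of [v] onto the span of the [e i]. *)
  apply/uN0/nN => v; pose c i := b (e i) v / n (e i).
  have vU : U (v - \sum_(j < k) c j *: e j).
    move=> i ik; rewrite polarDr // polarNr // (polar_orthobasis _ eB) //.
    by rewrite mulfVK ?subrr ?eN.
  have := isotropic_polar0 UD U0 _ vU; move/(_ u).
  rewrite polarDr // polarNr polar_sumr big1 => [|j _].
    by rewrite subr0; apply=> i ik; rewrite polarC eu.
  by rewrite polarZr // eu // mulr0.
exists (fun i => if (i < k)%N then e i else u); split=> [i _|i j].
  by case: ifP => // ik; apply: eN.
rewrite !ltnS => ik jk; case: ifP => [ik'|/negbT]; case: ifP => [jk'|/negbT].
- exact: eO.
- by move=> _ _; apply: uU.
- by move=> _ _; rewrite polarC; apply: uU.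
rewrite -!leqNgt => kj ki.
by rewrite (@anti_leq i k) ?ik // (@anti_leq j k) ?jk // eqxx.
Qed.

Section Basis.
Variable e : nat -> V.
Hypothesis eB : orthobasis 7 e.

(** In these vectors the Gram matrix is diagonal with nonzero entries, so the matrix [E] with
    columns [e j] is invertible. *)
Lemma orthobasis_decomp v : exists c : nat -> R, v = \sum_(i < 7) c i *: e i.
Proof.
pose E : 'M[R]_7 := \matrix_(i, j) e j i 0.
pose d : 'rV[R]_7 := \row_j n (e j).
have EGE : E^T *m gram *m E = diag_mx d.
  apply/matrixP => i j; rewrite [RHS]mxE mxE.
  have -> : d 0 i *+ (i == j) = b (e i) (e j).
    rewrite mxE; case: eqVneq => [->|ij]; first by rewrite -nQ.2.
    by rewrite eB.2.
  rewrite polar_gram mxE; apply: eq_bigr => k _; rewrite !mxE; congr (_ * _).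
  by apply: eq_bigr => l _; rewrite !mxE.
have Eu : E \in unitmx.
  have : diag_mx d \in unitmx.
    rewrite unitmxE det_diag unitfE prodf_seq_neq0; apply/allP => i _ /=.
    by rewrite mxE eB.1.
  by rewrite -EGE unitmx_mul => /andP[].
pose c := invmx E *m v; exists (fun i => c (inord i) 0).
rewrite -[LHS](mulKVmx Eu) -/c; apply/colP => i; rewrite mxE summxE.
by apply: eq_bigr => j _; rewrite !mxE inord_val mulrC.
Qed.

End Basis.
End QuadraticForm.

(** * Reflections from conjugation in the Clifford algebra *)

Section CliffordAction.
Variables (R : realType) (n : 'cV[R]_7 -> R).
Hypothesis nQ : quadratic_form n.
Local Notation V := 'cV[R]_7.
Local Notation b := (polar n).
Local Notation Cl := (clifford (fun v : V => - n v)).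
Local Notation gen := (clifford_gen (fun v : V => - n v)).
Local Notation gens a := (\prod_(v <- a) clifford_gen (fun v : V => - n v) v).

Definition refl (a v : V) : V := v - (2 * b a v / n a) *: a.

(** The last reflection of the list acts first, as in the Clifford product [gens a]. *)
Definition refls (a : seq V) (v : V) : V := foldr refl v a.

Lemma refl_isometry a u v : n a != 0 -> b (refl a u) (refl a v) = b u v.
Proof.
move=> na; rewrite /refl !(polar_expand nQ) -nQ.2 (polarC n u a); field.
exact: na.
Qed.

Lemma refls_isometry a u v : all (fun x => n x != 0) a ->
  b (refls a u) (refls a v) = b u v.
Proof. by elim: a => //= x a IH /andP[nx na]; rewrite refl_isometry // IH. Qed.

Lemma refl_orth a v : b a v = 0 -> refl a v = v.
Proof. by move=> av; rewrite /refl av mulr0 mul0r scale0r subr0. Qed.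

Lemma gen_anticomm u v :
  gen u * gen v + gen v * gen u = - (2 * b u v) *: (1 : Cl).
Proof.
have := clifford_gen_sqr (fun v : V => - n v) (u + v).
rewrite linearD mulrDl !mulrDr !clifford_gen_sqr => E.
have -> : - (2 * b u v) = - n (u + v) - (- n u) - (- n v).
  by rewrite /polar; field.
apply: (addIr ((- n v) *: (1 : Cl))); apply: (addIr ((- n u) *: (1 : Cl))).
by rewrite -!scalerDl !subrK -E /= addrC !addrA.
Qed.

Lemma gen_refl a v : n a != 0 -> gen a * gen v = - (gen (refl a v) * gen a).
Proof.
move=> na; rewrite /refl linearB linearZ /= mulrBl -clifford_scaleAl.
rewrite clifford_gen_sqr scalerA mulrN divfK // opprB -gen_anticomm.
rewrite [gen a * _ + _]addrC.
by rewrite addrAC subrr add0r.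
Qed.

Lemma gens_refls a v : all (fun x => n x != 0) a ->
  gens a * gen v = (-1) ^+ size a *: (gen (refls a v) * gens a).
Proof.
elim: a => [|x a IH] /=; first by rewrite !big_nil mul1r mulr1 scale1r.
case/andP=> nx na; rewrite !big_cons -mulrA IH //.
rewrite -clifford_scaleAr mulrA gen_refl //.
by rewrite exprS mulN1r scaleNr -scalerN mulNr mulrA.
Qed.

End CliffordAction.

(** * Even central products of vectors in the Clifford algebra *)

Section EvenCenter.
Variables (R : realType) (n : 'cV[R]_7 -> R).
Hypothesis nQ : quadratic_form n.
Variable e : nat -> 'cV[R]_7.
Hypothesis eB : orthobasis n 7 e.
Local Notation V := 'cV[R]_7.
Local Notation Cl := (clifford (fun v : V => - n v)).
Local Notation gen := (clifford_gen (fun v : V => - n v)).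
Local Notation gens a := (\prod_(v <- a) clifford_gen (fun v : V => - n v) v).
Local Notation below7 := (all (fun i => (i < 7)%N)).

Definition cl_scalar (x : Cl) : Prop := exists c : R, x = c *: (1 : Cl).

Lemma cl_scalar_comb (a : R) x y :
  cl_scalar x -> cl_scalar y -> cl_scalar (a *: x + y).
Proof.
by move=> [c ->] [d ->]; exists (a * c + d); rewrite scalerA -scalerDl.
Qed.

(** Indices may repeat and come in any order, which avoids normal forms in the Clifford algebra. *)
Definition monomial (s : seq nat) : Cl := \prod_(i <- s) gen (e i).

(** Each factor different from [gen (e i)] contributes a sign, and each factor equal to it none; the
    exponent has the parity of [size s - count_mem i s]. *)
Lemma gen_monomial i s : (i < 7)%N -> below7 s ->
  gen (e i) * monomial s =
    (-1) ^+ (size s + count_mem i s) *: (monomial s * gen (e i)).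
Proof.
move=> i7; elim: s => [|j s IH] /=.
  by rewrite /monomial big_nil mulr1 mul1r scale1r.
case/andP=> j7 /IH {}IH; rewrite /monomial !big_cons -/(monomial s).
case: (eqVneq j i) => [ji|ji].
  rewrite ji [in LHS]IH -clifford_scaleAr mulrA.
  by rewrite addSnnS add1n !addnS !exprS !mulN1r opprK.
have -> : gen (e i) * (gen (e j) * monomial s) =
    - (gen (e j) * (gen (e i) * monomial s)).
  rewrite !mulrA -mulNr; congr (_ * _); apply/eqP; rewrite -addr_eq0; apply/eqP.
  by rewrite gen_anticomm // eB.2 1?eq_sym // mulr0 oppr0 scale0r.
by rewrite IH add0n addSn exprS mulN1r scaleNr -clifford_scaleAr mulrA.
Qed.

(** By induction on the length: the first index occurs again, its first factor is moved next to the
    second occurrence, and their product is a scalar. *)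
Lemma monomial_even_scalar s : below7 s ->
  (forall i, ~~ odd (count_mem i s)) -> cl_scalar (monomial s).
Proof.
have [m] := ubnP (size s); elim: m s => // m IH [|j s] /=.
  by move=> _ _ _; exists 1; rewrite /monomial big_nil scale1r.
rewrite ltnS => sm /andP[j7 s7] ev.
have js : j \in s.
  rewrite -has_pred1 has_count; have := ev j; rewrite eqxx add1n /= negbK.
  exact: odd_gt0.
case/splitPr: js sm s7 ev => s1 s2; rewrite size_cat /= addnS => sm.
rewrite all_cat /= => /and3P[s17 _ s27] ev.
have [|||c cE] := IH (s1 ++ s2).
- by rewrite size_cat; apply: leq_trans sm.
- by rewrite all_cat s17.
- move=> i; have := ev i; rewrite !count_cat /= !oddD.
  by case: (j == i) => /=; case: (odd _) => /=; case: (odd _).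
exists ((-1) ^+ (size s1 + count_mem j s1) * - n (e j) * c).
rewrite -[_ * _ * c *: _]scalerA -cE /monomial !big_cons !big_cat big_cons /=.
rewrite -!/(monomial _) mulrA gen_monomial // -clifford_scaleAl -mulrA.
rewrite (mulrA (gen _)) clifford_gen_sqr -clifford_scaleAl mul1r.
by rewrite -clifford_scaleAr scalerA.
Qed.

(* The inverse of [gen (e i)] is [- (n (e i))^-1 *: gen (e i)]. *)
Definition average i (x : Cl) : Cl :=
  2^-1 *: (x - (n (e i))^-1 *: (gen (e i) * x * gen (e i))).

Definition averages (s : seq nat) (x : Cl) : Cl := foldr average x s.

Lemma average_linear i : linear (average i).
Proof.
move=> a x y; rewrite /average mulrDr mulrDl.
rewrite -clifford_scaleAr -clifford_scaleAl.
set X := gen _ * x * _; set Y := gen _ * y * _; set k := (n _)^-1.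
rewrite (scalerDr k) opprD addrACA scalerDr; congr (_ + _).
by rewrite !scalerBr !scalerA; congr (_ *: _ - _ *: _); ring.
Qed.

Lemma averages_linear s : linear (averages s).
Proof. by move=> a x y; elim: s => //= i s ->; rewrite average_linear. Qed.

Lemma averages0 s : averages s 0 = 0.
Proof.
by elim: s => //= i s ->; rewrite /average mulr0 mul0r scaler0 subr0 scaler0.
Qed.

Lemma average_comm i x : (i < 7)%N -> gen (e i) * x = x * gen (e i) ->
  average i x = x.
Proof.
move=> i7 xC; rewrite /average xC -mulrA clifford_gen_sqr.
rewrite -clifford_scaleAr mulr1 scalerA mulrN mulVf ?eB.1 // scaleN1r opprK.
rewrite scalerDr -scalerDl.
by have -> : 2^-1 + 2^-1 = 1 :> R; [field|rewrite scale1r].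
Qed.

Lemma averages_comm s x : below7 s ->
  (forall i, (i < 7)%N -> gen (e i) * x = x * gen (e i)) -> averages s x = x.
Proof.
move=> + xC; elim: s => //= i s IH /andP[i7 /IH ->].
by rewrite average_comm ?xC.
Qed.

Lemma average_monomial i s : (i < 7)%N -> below7 s -> ~~ odd (size s) ->
  average i (monomial s) = if odd (count_mem i s) then 0 else monomial s.
Proof.
move=> i7 s7 se; case: ifP => ci; last first.
  rewrite average_comm // gen_monomial // -signr_odd oddD ci (negPf se).
  by rewrite scale1r.
rewrite /average gen_monomial // -signr_odd oddD ci (negPf se) scaleN1r.
rewrite mulNr -mulrA clifford_gen_sqr -clifford_scaleAr mulr1 scaleNr opprK.
by rewrite scalerA mulVf ?eB.1 // scale1r subrr scaler0.
Qed.

Lemma averages_monomial s : below7 s -> ~~ odd (size s) ->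
  cl_scalar (averages (iota 0 7) (monomial s)).
Proof.
move=> s7 se.
have [all_even|] := boolP (all (fun i => ~~ odd (count_mem i s)) (iota 0 7)).
  have ev i : ~~ odd (count_mem i s).
    case: (ltnP i 7) => i7; first by apply: (allP all_even); rewrite mem_iota.
    rewrite (count_memPn _) //; apply/negP => /(allP s7).
    by rewrite ltnNge i7.
  suff -> : averages (iota 0 7) (monomial s) = monomial s.
    exact: monomial_even_scalar.
  have: below7 (iota 0 7) by [].
  elim: (iota 0 7) => //= i r IH /andP[i7 /IH ->].
  by rewrite average_monomial // (negPf (ev i)).
rewrite -has_predC; have: below7 (iota 0 7) by [].
suff: forall r, below7 r ->
    averages r (monomial s) = if has (predC (fun i => ~~ odd (count_mem i s))) r
                              then 0 else monomial s.
  by move=> E r7 h; exists 0; rewrite E // h scale0r.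
elim=> //= i r IH /andP[i7 /IH ->]; rewrite negbK orbC.
case: (has _ r); last by rewrite average_monomial.
exact: (averages0 [:: i]).
Qed.

(** The vectors of [a] are expanded in the basis one at a time, and the prefix [s] collects the
    basis vectors already chosen; linearity of the averages reduces to monomials. *)
Lemma averages_gens s a : below7 s -> ~~ odd (size s + size a) ->
  cl_scalar (averages (iota 0 7) (monomial s * gens a)).
Proof.
elim: a s => [|v a IH] s s7.
  by rewrite big_nil mulr1 addn0; apply: averages_monomial.
(* The appended [0] is a dummy index: only the size of the list enters the parity. *)
rewrite big_cons [size (v :: a)]/= addnS -addSn -(size_rcons s 0%N) => se.
have [c ->] := orthobasis_decomp nQ eB v.
have -> : monomial s * (gen (\sum_(i < 7) c i *: e i) * gens a) =
    \sum_(i < 7) c i *: (monomial (rcons s i) * gens a).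
  rewrite linear_sum mulr_suml mulr_sumr; apply: eq_bigr => i _.
  rewrite linearZ -clifford_scaleAl -clifford_scaleAr mulrA.
  by rewrite /monomial -cats1 big_cat big_seq1.
apply: (big_rec (fun x => cl_scalar (averages (iota 0 7) x))) => [|i x _ xS].
  by exists 0; rewrite averages0 scale0r.
rewrite averages_linear; apply: cl_scalar_comb => //; apply: IH.
  by rewrite all_rcons ltn_ord.
by move: se; rewrite !size_rcons.
Qed.

(* The average of a monomial over conjugation by [e i] vanishes when [e i]
   occurs an odd number of times in it, and equals the monomial otherwise. *)
Lemma even_central_scalar a : ~~ odd (size a) ->
  (forall v, gen v * gens a = gens a * gen v) -> cl_scalar (gens a).
Proof.
move=> ae aC; have := @averages_gens [::] a isT ae.
by rewrite /monomial big_nil mul1r averages_comm // => i _; apply: aC.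
Qed.

End EvenCenter.

(** * Cross product identities, multiplicativity of the norm, and the commutant of the left
    multiplications *)

Section Representation.
Variables (R : realType) (w : 'cV[R]_7 -> 'cV[R]_7 -> 'cV[R]_7 -> R).
Variable n : 'cV[R]_7 -> R.
Hypotheses (wG : generic w) (nw : related_norm w n).
Local Notation V := 'cV[R]_7.
Local Notation oct := (R^o * 'cV[R]_7)%type.
Local Notation b := (polar n).
Local Notation Cl := (clifford (fun v : V => - n v)).
Local Notation gen := (clifford_gen (fun v : V => - n v)).
Local Notation gens a := (\prod_(v <- a) clifford_gen (fun v : V => - n v) v).
Local Notation "X ** Y" := (cross n w X Y) (at level 40, left associativity).
Local Notation L := (oct_lmul n w).
Local Notation rho := (@spin_rep R n w).

Let nQ : quadratic_form n. Proof. by case: nw. Qed.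
Let nN : nondegenerate_form n. Proof. by case: nw. Qed.

Lemma crossDr X Y Z : X ** (Y + Z) = X ** Y + X ** Z.
Proof. by have := cross_linear_r wG nw X 1 Y Z; rewrite !scale1r. Qed.

Lemma cross0r X : X ** 0 = 0.
Proof. by apply: (addrI (X ** 0)); rewrite -crossDr !addr0. Qed.

Lemma crossZr X a Y : X ** (a *: Y) = a *: (X ** Y).
Proof. by have := cross_linear_r wG nw X a Y 0; rewrite cross0r !addr0. Qed.

Lemma crossDl X Y Z : (Y + Z) ** X = Y ** X + Z ** X.
Proof. by have := cross_linear_l wG nw X 1 Y Z; rewrite !scale1r. Qed.

Lemma crossxx X : X ** X = 0.
Proof.
apply: (polar_inj nQ nN) => Z; rewrite (crossP wG.1 nQ nN) polar0l //.
by have [_ _ _ alt] := wG.1; have [-> _ _] := alt X Z.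
Qed.

Lemma crossC X Y : X ** Y = - (Y ** X).
Proof.
have := crossxx (X + Y); rewrite crossDl !crossDr !crossxx add0r addr0.
by move/eqP; rewrite addr_eq0 => /eqP.
Qed.

(** Polarization of [cross_cross] in its repeated argument. *)
Lemma cross_crossD X Y Z : X ** (Y ** Z) + Y ** (X ** Z) =
  b X Z *: Y + b Y Z *: X - (2 * b X Y) *: Z.
Proof.
have := cross_cross wG nw (X + Y) Z.
rewrite !crossDl !crossDr !(cross_cross wG nw) polarDl // => E.
have -> : 2 * b X Y = n (X + Y) - n X - n Y by rewrite /polar; field.
have {E} : X ** (Y ** Z) + Y ** (X ** Z) =
    (b X Z + b Y Z) *: (X + Y) - n (X + Y) *: Z - (b X Z *: X - n X *: Z)
    - (b Y Z *: Y - n Y *: Z).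
  by rewrite -E; apply/colP => i; rewrite !mxE; ring.
by move=> ->; apply/colP => i; rewrite !mxE; ring.
Qed.

Lemma lmulE u (x : oct) : L u x = (- b u x.2, x.1 *: u + u ** x.2).
Proof.
by rewrite (oct_lmulE wG nw) /oct_mul /= mul0r sub0r scale0r add0r.
Qed.

(** The square of the real part of [L u x] cancels the negative term of [n (u ** x.2)], and [u] is
    orthogonal to [u ** x.2]. *)
Lemma oct_norm_lmul u x : oct_norm n (L u x) = n u * oct_norm n x.
Proof.
have [_ _ orth ncross] := nw; rewrite lmulE /oct_norm /=; case: x => y Y /=.
rewrite [n (_ + _)]nQ.2 !(polar_expand nQ) -!nQ.2 ncross.
by rewrite (polarC n u (u ** Y)) (orth u Y).1; ring.
Qed.

Lemma oct_normN x : oct_norm n (- x) = oct_norm n x.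
Proof.
by rewrite /oct_norm /= sqrrN [n (- _)]nQ.2 !(polar_expand nQ) opprK -nQ.2.
Qed.

Lemma oct_normZ (c : R) x : oct_norm n (c *: x) = c ^+ 2 * oct_norm n x.
Proof.
rewrite /oct_norm /= [n (c *: _)]nQ.2 !(polar_expand nQ) -nQ.2.
by rewrite -[c *: x.1]/(c * x.1); ring.
Qed.

Lemma spin_rep_scale (c : R) (g : Cl) : rho (c *: g) = c *: rho g.
Proof.
have rho0 : rho 0 = 0.
  have := spin_rep_is_linear wG nw (-1) 0 0.
  by rewrite !scaleN1r !addNr.
by have := spin_rep_is_linear wG nw c g 0; rewrite rho0 !addr0.
Qed.

Lemma spin_repN (g : Cl) : rho (- g) = - rho g.
Proof. by rewrite -scaleN1r spin_rep_scale scaleN1r. Qed.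

Lemma oct_norm_gens a x :
  oct_norm n (rho (gens a) x) = (\prod_(v <- a) n v) * oct_norm n x.
Proof.
elim: a => [|v a IH].
  by rewrite !big_nil (spin_rep1 wG nw) id_lfunE mul1r.
rewrite !big_cons (spin_repM wG nw) comp_lfunE (spin_rep_gen wG nw).
by rewrite oct_norm_lmul IH mulrA.
Qed.

Lemma oct_norm_spin_act (g : spin_group n) x :
  oct_norm n (spin_act w g x) = oct_norm n x.
Proof.
rewrite /spin_act; case: g => g /= /asboolP [r [a [_ na gE]]].
by case: gE => /= ->;
  rewrite ?spin_repN ?opp_lfunE ?oct_normN oct_norm_gens na mul1r.
Qed.

Lemma lmul_gens a v x : all (fun u => n u != 0) a ->
  rho (gens a) (L v x) = (-1) ^+ size a *: L (refls n a v) (rho (gens a) x).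
Proof.
move=> na; rewrite -!(spin_rep_gen wG nw) -!comp_lfunE -!(spin_repM wG nw).
by rewrite gens_refls // spin_rep_scale scale_lfunE.
Qed.

Lemma lmul_one v : L v oct_one = (0, v).
Proof. by rewrite lmulE /= polar0r // oppr0 cross0r scale1r addr0. Qed.

Lemma lmul_inj u v : (forall x, L u x = L v x) -> u = v.
Proof. by move/(_ oct_one); rewrite !lmul_one => -[]. Qed.

(* Such an [h] is right multiplication by [h 1], so the imaginary part [C] of
   [h 1] associates with all pairs of vectors.  If [e] is orthogonal to [u],
   [C] and [u ** C], then associativity of [u], [e], [C] means
   [e ** (u ** C) = 0]. *)
Lemma lmul_commutant (h : 'End(oct)) : (forall v x, h (L v x) = L v (h x)) ->
  exists c : R, h = c *: \1%VF.
Proof.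
move=> hL; case h1: (h oct_one) => [c C].
have hV v : h (0, v) = (- b v C, c *: v + v ** C).
  by rewrite -lmul_one hL h1 lmulE.
have assoc u v : (u ** v) ** C = b u v *: C - b v C *: u + u ** (v ** C).
  have := hL u (0, v); rewrite lmulE /= scale0r add0r hV lmulE /=.
  have -> : (- b u v, u ** v) = (- b u v : R) *: (oct_one : oct) + (0, u ** v).
    by apply: oct_ext; rewrite /= ?scaler0 ?add0r // addr0 [_ *: _]mulr1.
  rewrite linearD linearZ /= h1 hV => /(congr1 snd) /=.
  rewrite crossDr crossZr => E.
  have -> : (u ** v) ** C = - b u v *: C + (c *: (u ** v) + u ** v ** C)
      + b u v *: C - c *: (u ** v).
    by apply/colP => i; rewrite !mxE; ring.
  by rewrite E; apply/colP => i; rewrite !mxE; ring.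
have uC u : u ** C = 0.
  have [//|e eN eo] :=
    @exists_orth_nonisotropic _ n nQ nN [:: u; C; u ** C].
  have eu : b e u = 0 by apply: eo; rewrite !inE eqxx.
  have eC : b e C = 0 by apply: eo; rewrite !inE eqxx orbT.
  have euC : b e (u ** C) = 0 by apply: eo; rewrite !inE eqxx !orbT.
  have H1 := assoc u e; have H2 := cross_crossD C u e.
  have H3 := cross_crossD u e C.
  rewrite (polarC n u e) eu eC !scale0r subrr add0r in H1.
  rewrite (polarC n u e) (polarC n C e) eu eC !scale0r !add0r in H2.
  rewrite (polarC n u e) eu eC mulr0 !scale0r subr0 addr0 in H3.
  rewrite crossC in H1; rewrite (crossC C e) -scaleN1r crossZr scaleN1r in H2.
  (* With [p], [q], [r] as below, the three relations read [q = - p], [p - q = - (2 * b C u) *: e]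
     and [q + r = b u C *: e], whence [r = 0]. *)
  have e0 : e ** (u ** C) = 0.
    move: H1 H2 H3; set p := C ** (u ** e); set q := u ** (e ** C).
    set r := e ** (u ** C) => H1 H2 H3; rewrite -H1 in H2 H3.
    rewrite (polarC n u C) in H3.
    apply/colP => i; move/colP/(_ i): H2; move/colP/(_ i): H3; rewrite !mxE.
    by lra.
  (* On vectors orthogonal to [e], crossing twice with [e] is multiplication by [- n e], which is
     nonzero. The same argument with [u] gives [C0]. *)
  have := cross_cross wG nw e (u ** C); rewrite e0 cross0r euC scale0r sub0r.
  move/esym/eqP; rewrite oppr_eq0 scaler_eq0 (negPf eN) /=.
  by move/eqP.
have C0 : C = 0.
  have [//|u uN uo] := @exists_orth_nonisotropic _ n nQ nN [:: C].
  have := cross_cross wG nw u C; rewrite uC cross0r uo ?inE ?eqxx //.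
  rewrite scale0r sub0r.
  by move/esym/eqP; rewrite oppr_eq0 scaler_eq0 (negPf uN) => /eqP.
exists c; apply/lfunP => -[y Y]; rewrite scale_lfunE id_lfunE.
have -> : (y, Y) = (y : R) *: (oct_one : oct) + (0, Y) :> oct.
  by apply: oct_ext; rewrite /= ?scaler0 ?add0r // addr0 [_ *: _]mulr1.
rewrite linearD linearZ /= h1 hV C0 polar0r // cross0r oppr0.
by apply: oct_ext => /=; rewrite ?scaler0 ?addr0 ?add0r // /GRing.scale /=;
  ring.
Qed.

End Representation.

(** * Matching orthogonal families by even products of reflections *)

Section Reflections.
Variables (R : realType) (n : 'cV[R]_7 -> R).
Hypothesis nQ : quadratic_form n.
Local Notation V := 'cV[R]_7.
Local Notation b := (polar n).

Let nD p q : n (p + q) = n p + n q + 2 * b p q.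
Proof. by rewrite /polar; field. Qed.

Lemma refl_sum p q : n p = n q -> n (p + q) != 0 -> refl n (p + q) p = - q.
Proof.
move=> pq; rewrite /refl; have -> : n (p + q) = 2 * b (p + q) p.
  by rewrite nD polarDl // -nQ.2 (polarC n q) pq; ring.
by move=> pqN; rewrite divff // scale1r opprD addrA subrr add0r.
Qed.

Lemma refl_self q : n q != 0 -> refl n q q = - q.
Proof.
move=> qN; rewrite /refl -nQ.2 mulfK // scaler_nat mulr2n opprD addrA.
by rewrite subrr add0r.
Qed.

Lemma reflN a v : refl n a (- v) = - refl n a v.
Proof. by rewrite /refl polarNr // mulrN mulNr scaleNr opprD. Qed.

Lemma refl_diff p q : n p = n q -> n (p - q) != 0 -> refl n (p - q) p = q.
Proof.
move=> pq pqN; rewrite refl_sum ?opprK // pq.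
by rewrite [RHS]nQ.2 polarNl // polarNr // opprK -nQ.2.
Qed.

Lemma refls_cat s t v : refls n (s ++ t) v = refls n s (refls n t v).
Proof. by rewrite /refls foldr_cat. Qed.

(* Cartan-Dieudonne, one basis vector at a time: if [p] has to be sent to [q],
   then [p - q] or [p + q] is nonisotropic, and the spare basis vector allows an
   even number of reflections in both cases. *)
Lemma even_refls_orthobasis m (e e' : nat -> V) k : orthobasis n m e ->
  (forall i j, (i < m)%N -> (j < m)%N -> b (e' i) (e' j) = b (e i) (e j)) ->
  (k < m)%N ->
  exists a, [/\ ~~ odd (size a), all (fun x => n x != 0) a
    & forall i, (i < k)%N -> refls n a (e i) = e' i].
Proof.
move=> [eN eO] e'E; elim: k => [|k IH] km; first by exists [::].
have [a [a2 aN aE]] := IH (ltnW km).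
have k0m : (k < m)%N := ltnW km.
pose p := refls n a (e k); pose q := e' k; pose z := refls n a (e k.+1).
have nq : n q = n (e k) by rewrite !nQ.2 e'E.
have np : n p = n q by rewrite nq [LHS]nQ.2 refls_isometry // -nQ.2.
have qN : n q != 0 by rewrite nq eN.
have im i : (i < k)%N -> (i < m)%N by move=> ik; apply: ltn_trans k0m.
have qo i : (i < k)%N -> b q (e' i) = 0.
  by move=> ik; have imi := im i ik; rewrite e'E // eO // gtn_eqF.
have po i : (i < k)%N -> b p (e' i) = 0.
  move=> ik; have imi := im i ik.
  by rewrite -aE // refls_isometry // eO // gtn_eqF.
(* The reflection in [p + q] sends [p] to [- q], and the one in [q] corrects the sign. Both fix the
   vectors already matched, since these are orthogonal to [p] and [q]. *)
have [pq0|pqN] := eqVneq (n (p + q)) 0; last first.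
  exists ([:: q; p + q] ++ a); split; first by rewrite size_cat /= negbK.
    by rewrite all_cat aN /= qN pqN.
  move=> i; rewrite ltnS leq_eqVlt refls_cat => /predU1P[->|ik] /=.
    by rewrite refl_sum // reflN refl_self // opprK.
  by rewrite aE // !refl_orth ?polarDl // ?po ?qo // addr0.
have zN : n z != 0 by rewrite nQ.2 refls_isometry // -nQ.2 eN.
have zp : b z p = 0 by rewrite refls_isometry // eO // gtn_eqF.
have zo i : (i < k)%N -> b z (e' i) = 0.
  move=> ik; have imi := im i ik.
  by rewrite -aE // refls_isometry // eO // gtn_eqF // ltnS ltnW.
(* By the parallelogram law [n (p + q) + n (p - q) = 4 * n q]. The reflection in [p - q] alone would
   suffice for [p]; the one in [z], which fixes [p] and the matched vectors, makes the number
   even. *)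
have pqN : n (p - q) != 0.
  apply: contraNneq qN => pq0'; have := nD p q; have := nD p (- q).
  have -> : n (- q) = n q.
    by rewrite [LHS]nQ.2 polarNl // polarNr // opprK -nQ.2.
  by rewrite pq0 pq0' polarNr // np => E1 E2; apply/eqP; lra.
exists ([:: p - q; z] ++ a); split; first by rewrite size_cat /= negbK.
  by rewrite all_cat aN /= zN pqN.
move=> i; rewrite ltnS leq_eqVlt refls_cat => /predU1P[->|ik] /=.
  by rewrite (refl_orth zp) refl_diff.
by rewrite aE // !refl_orth ?zo // polarDl // polarNl // po // qo // subr0.
Qed.

End Reflections.

(** * Transitivity on the unit quadric and faithfulness of the spin representation *)

Section SpinAndAutomorphisms.
Variables (R : realType) (w : 'cV[R]_7 -> 'cV[R]_7 -> 'cV[R]_7 -> R).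
Variable n : 'cV[R]_7 -> R.
Hypotheses (wG : generic w) (nw : related_norm w n).
Local Notation V := 'cV[R]_7.
Local Notation oct := (R^o * 'cV[R]_7)%type.
Local Notation b := (polar n).
Local Notation Cl := (clifford (fun v : V => - n v)).
Local Notation gen := (clifford_gen (fun v : V => - n v)).
Local Notation gens a := (\prod_(v <- a) clifford_gen (fun v : V => - n v) v).
Local Notation L := (oct_lmul n w).
Local Notation rho := (@spin_rep R n w).

Let nQ : quadratic_form n. Proof. by case: nw. Qed.
Let nN : nondegenerate_form n. Proof. by case: nw. Qed.

Lemma lmul_sqr u x : L u (L u x) = - n u *: x.
Proof.
by rewrite -comp_lfunE (oct_lmul_sqr wG nw) scale_lfunE id_lfunE.
Qed.

Lemma spin_gens (a : seq V) : ~~ odd (size a) -> \prod_(v <- a) n v = 1 ->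
  spin n (gens a).
Proof.
move=> a2 na; exists (size a)./2, a; split=> //; last by left.
by rewrite mul2n even_halfK.
Qed.

Lemma spin_group_lift (g : Cl) : spin n g -> exists h : spin_group n, val h = g.
Proof. by move=> /asboolT gS; exists (exist _ g gS). Qed.

Lemma spin_gensP (g : spin_group n) : exists a, [/\ ~~ odd (size a),
  all (fun v => n v != 0) a & val g = gens a \/ val g = - gens a].
Proof.
case: g => g /= /asboolP [r [a [sa na gE]]]; exists a; split=> //.
  by rewrite sa oddM.
have: \prod_(v <- a) n v != 0 by rewrite na oner_eq0.
by rewrite prodf_seq_neq0.
Qed.

(* For [u] orthogonal to the imaginary part of [x], [u^-1 x] is imaginary. *)
Lemma spin_act_from_one (x : oct) : oct_norm n x = 1 ->
  exists g : spin_group n, spin_act w g oct_one = x.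
Proof.
move=> x1.
have [//|u uN uo] := @exists_orth_nonisotropic _ n nQ nN [:: x.2].
(* As [L u] squares to [- n u], the inverse of [u] is [t *: u], so [x] is the product of [u] and
   [t *: v]; since [n v = n u], the norms of these two factors multiply to 1. *)
pose v : V := (L u x).2; pose t := - (n u)^-1.
have uxE : L u x = (0, v).
  by apply: oct_ext => //=; rewrite (lmulE wG nw) /= uo ?oppr0 // inE.
have vE : L u (0, t *: v) = x.
  have -> : (0, t *: v) = t *: (0, v) :> oct.
    by apply: oct_ext; rewrite //= scaler0.
  by rewrite linearZ -uxE /= lmul_sqr scalerA mulrNN mulVf // scale1r.
have nv : n v = n u.
  have := oct_norm_lmul wG nw u x; rewrite x1 mulr1 uxE /oct_norm /=.
  by rewrite expr0n add0r.
have gS : spin n (gens [:: u; t *: v]).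
  apply: spin_gens => //; rewrite !big_cons big_nil mulr1 [n (t *: v)]nQ.2.
  by rewrite polarZl // polarZr // -nQ.2 nv /t; field.
have [g gE] := spin_group_lift gS; exists g.
rewrite /spin_act gE !big_cons big_nil mulr1 (spin_repM wG nw) comp_lfunE.
by rewrite !(spin_rep_gen wG nw) (lmul_one wG nw).
Qed.

Lemma spin_act_trans (x y : oct) : oct_norm n x = 1 -> oct_norm n y = 1 ->
  exists g : spin_group n, spin_act w g x = y.
Proof.
move=> /spin_act_from_one[g <-] /spin_act_from_one[h <-].
exists (h * g^-1)%g.
by rewrite -(spin_actM wG nw) mulgVK.
Qed.

Lemma spin_act_lmul (g : spin_group n) : exists s : V -> V,
  forall v x, spin_act w g (L v x) = L (s v) (spin_act w g x).
Proof.
have [a [a2 aN gE]] := spin_gensP g; exists (refls n a) => v x.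
rewrite /spin_act; case: gE => ->.
  by rewrite (lmul_gens wG nw) // -signr_odd (negPf a2) scale1r.
rewrite (spin_repN wG nw) !opp_lfunE (lmul_gens wG nw) // -signr_odd (negPf a2).
by rewrite scale1r linearN.
Qed.

Lemma oct_mulE x y : oct_mul n w x y = x.1 *: y + L x.2 y.
Proof.
rewrite (oct_lmulE wG nw); apply: oct_ext; rewrite /= ?mul0r ?sub0r //.
by rewrite scale0r add0r addrA.
Qed.

Lemma oct_decomp (x : oct) : x = x.1 *: (oct_one : oct) + (0, x.2).
Proof.
by apply: oct_ext; rewrite /= ?scaler0 ?add0r // addr0 [_ *: _]mulr1.
Qed.

(** Evaluating [g (v x) = s(v) (g x)] at [x = 1] gives [g v = s(v)], so the relation is
    multiplicativity for an imaginary left factor; linearity handles its real part. *)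
Lemma isotropy_automorphism (g : spin_group n) :
  spin_act w g oct_one = oct_one -> oct_automorphism n w (rho (val g)).
Proof.
move=> g1; split.
  exists (rho (val (g^-1)%g)) => x.
    by have := spin_actM wG nw (g^-1)%g g x; rewrite mulVg (spin_act1 wG nw).
  by have := spin_actM wG nw g (g^-1)%g x; rewrite mulgV (spin_act1 wG nw).
have [s sP] := spin_act_lmul g.
have gV v : rho (val g) (0, v) = (0, s v).
  have := sP v oct_one; rewrite g1 !(lmul_one wG nw) //.
have g1' : rho (val g) oct_one = oct_one := g1.
move=> x y; rewrite oct_mulE linearD linearZ /= [rho _ (L _ _)]sP.
rewrite [in RHS](oct_decomp x) linearD linearZ /= g1' gV oct_mulE /=.
by rewrite addr0 scaler0 add0r [_ *: 1]mulr1.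
Qed.

Lemma spin_rep_faithful (g : spin_group n) : rho (val g) = \1%VF -> g = 1%g.
Proof.
move=> g1; have [a [a2 aN gE]] := spin_gensP g.
have [e eB] := exists_orthobasis nQ nN (leqnn 7).
(* A trivial action gives [L v = L (refls n a v)], and [L] is injective. *)
have sa v : refls n a v = v.
  apply: (lmul_inj wG nw) => x; have := lmul_gens wG nw v x aN.
  rewrite -signr_odd (negPf a2) scale1r.
  case: gE g1 => ->; rewrite ?(spin_repN wG nw).
    by move=> ->; rewrite !id_lfunE.
  move/(canRL (@opprK _)) => ->.
  by rewrite !opp_lfunE !id_lfunE linearN => /oppr_inj.
have aC v : gen v * gens a = gens a * gen v.
  by rewrite gens_refls // sa -signr_odd (negPf a2) scale1r.
have [c cE] := even_central_scalar nQ eB a2 aC.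
have [d gd] : exists d, val g = d *: (1 : Cl).
  by case: gE => ->; rewrite cE; [exists c|exists (- c); rewrite scaleNr].
move: g1; rewrite gd (spin_rep_scale wG nw) (spin_rep1 wG nw) => d1.
apply: val_inj; rewrite gd.
have := congr1 (fun f : 'End(oct) => (f oct_one).1) d1.
by rewrite scale_lfunE id_lfunE /= [_ *: 1]mulr1 => ->; rewrite scale1r.
Qed.

(** * Automorphisms restrict to isometries of the imaginary octonions *)

Section Automorphism.
Variable f : 'End(oct).
Hypothesis fA : oct_automorphism n w f.

Lemma automorphism_one : f oct_one = oct_one.
Proof.
have [[g _ gK] fM] := fA; rewrite -[RHS]gK.
have m1 y : oct_mul n w oct_one y = y.
  rewrite oct_mulE /= scale1r (lmulE wG nw) polar0l // oppr0 scaler0 add0r.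
  by rewrite (crossC wG nw) (cross0r wG nw) oppr0 [LHS]addr0.
have m1r y : oct_mul n w y oct_one = y.
  by rewrite oct_mulE (lmul_one wG nw) -oct_decomp.
by rewrite -[g _]m1 fM gK m1r.
Qed.

Definition automorphism_im (v : V) : V := (f (0, v)).2.

(** The square of [x = f (0, v)] is real, and its imaginary part is [2 x.1 x.2]. If [x.1] were
    nonzero, [x] would be real, hence the image of a nonzero real, against injectivity. *)
Lemma automorphism_imE v : f (0, v) = (0, automorphism_im v).
Proof.
apply: oct_ext => //=; apply/eqP; apply: contrapT => /negP aN.
set x := f (0, v) in aN.
have : oct_mul n w x x = - n v *: (oct_one : oct).
  rewrite -fA.2 oct_mulE /= scale0r add0r -(lmul_one wG nw) lmul_sqr.
  by rewrite linearZ /= automorphism_one.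
rewrite oct_mulE (lmulE wG nw) => /(congr1 snd) /=.
rewrite crossxx // addr0 scaler0 -scalerDl => /eqP.
rewrite scaler_eq0 -mulr2n mulrn_eq0 (negPf aN) /= => /eqP x2.
have : x = f (x.1 *: (oct_one : oct)).
  by rewrite linearZ /= automorphism_one [LHS]oct_decomp x2 addr0.
move/(bij_inj fA.1) => /(congr1 fst) /= /esym/eqP.
by rewrite [_ *: 1]mulr1 (negPf aN).
Qed.

Lemma automorphism_lmul v x : f (L v x) = L (automorphism_im v) (f x).
Proof. by rewrite !(oct_lmulE wG nw) fA.2 automorphism_imE. Qed.

(** The norm is determined by the product, through [v v = - n v]. *)
Lemma automorphism_polar u v :
  b (automorphism_im u) (automorphism_im v) = b u v.
Proof.
have nE y : n (automorphism_im y) = n y.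
  have := automorphism_lmul y (L y oct_one).
  rewrite lmul_sqr automorphism_lmul lmul_sqr linearZ /= automorphism_one.
  by move/(congr1 fst); rewrite /= ![_ *: 1]mulr1 => /oppr_inj ->.
have imD : automorphism_im (u + v) = automorphism_im u + automorphism_im v.
  rewrite /automorphism_im -[_ + (f _).2]/(f (0, u) + f (0, v)).2 -linearD.
  by congr (f _).2; apply: oct_ext; rewrite //= addr0.
by rewrite /polar -imD !nE.
Qed.

End Automorphism.

(* The product of the left multiplications by [e 0, ..., e 6] is a nonzero
   scalar, so [L (e 6)] is proportional to the product of the six others. *)
Lemma commute_six (e : nat -> V) (h : 'End(oct)) : orthobasis n 7 e ->
  (forall i x, (i < 6)%N -> h (L (e i) x) = L (e i) (h x)) ->
  exists c : R, h = c *: \1%VF.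
Proof.
move=> eB hL; apply: (lmul_commutant wG nw).
have from_basis (f : 'End(oct)) :
    (forall i x, (i < 7)%N -> f (L (e i) x) = L (e i) (f x)) ->
    forall v x, f (L v x) = L v (f x).
  have L_linear : linear L := oct_lmul_is_linear wG nw.
  have LZD (c : nat -> R) x : L (\sum_(i < 7) c i *: e i) x =
      \sum_(i < 7) c i *: L (e i) x.
    elim/big_rec2: _ => [|i y v _ <-]; last first.
      by rewrite L_linear add_lfunE scale_lfunE.
    have := L_linear (-1) 0 0; rewrite !scaleN1r !addNr => ->.
    by rewrite zero_lfunE.
  move=> fL v x; have [c ->] := orthobasis_decomp nQ eB v.
  rewrite !LZD linear_sum; apply: eq_bigr => i _; rewrite linearZ /=.
  by rewrite fL.
pose mon s := monomial n e s.
(* Each [e i] passes the seven factors with the sign exponent [7 + 1], so it commutes with their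
   product. *)
have [k kE] : exists k : R, rho (mon (iota 0 7)) = k *: \1%VF.
  apply: (lmul_commutant wG nw); apply: from_basis => i x i7.
  rewrite -(spin_rep_gen wG nw) -!comp_lfunE -!(spin_repM wG nw).
  rewrite (gen_monomial eB) //.
  have -> : count_mem i (iota 0 7) = 1%N.
    by rewrite count_uniq_mem ?iota_uniq // mem_iota i7.
  by rewrite -signr_odd scale1r.
(* If [k] were 0, the image of 1 would have norm 0, whereas its norm is the product of the nonzero
   [n (e i)]. *)
have kN : k != 0.
  apply: contraNneq (oner_neq0 R) => k0.
  have := oct_norm_gens wG nw (mkseq e 7) oct_one.
  rewrite big_map -/(monomial n e _) -/(mon _) kE k0 scale0r zero_lfunE.
  rewrite /oct_norm /= nQ.2 polar0r // expr0n expr1n !addr0 mulr1.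
  rewrite big_map => /esym/eqP.
  rewrite prodf_seq_eq0 => /hasP[i]; rewrite mem_iota /= => i7.
  by rewrite (negPf (eB.1 i i7)).
have hmon s x : all (fun i => (i < 6)%N) s ->
    h (rho (mon s) x) = rho (mon s) (h x).
  elim: s => [|i s IH] /=.
    by rewrite /mon /monomial big_nil (spin_rep1 wG nw) !id_lfunE.
  case/andP=> i6 /IH {}IH; rewrite /mon /monomial big_cons (spin_repM wG nw).
  by rewrite !comp_lfunE (spin_rep_gen wG nw) hL // -/(monomial n e s) IH.
have L6 x : L (e 6%N) x = (- n (e 6%N) / k) *: rho (mon (iota 0 6)) x.
  have -> : L (e 6%N) x = k^-1 *: rho (mon (iota 0 7)) (L (e 6%N) x).
    by rewrite kE scale_lfunE id_lfunE scalerA mulVf // scale1r.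
  have -> : mon (iota 0 7) = mon (iota 0 6) * gen (e 6%N).
    rewrite /mon /monomial -[iota 0 7]/(iota 0 6 ++ [:: 6%N]).
    by rewrite big_cat big_seq1.
  rewrite (spin_repM wG nw) comp_lfunE (spin_rep_gen wG nw) lmul_sqr linearZ /=.
  by rewrite scalerA mulrC.
apply: from_basis => i x; rewrite ltnS leq_eqVlt => /predU1P[->|]; last first.
  exact: hL.
by rewrite !L6 linearZ /= hmon.
Qed.

Lemma automorphism_spin (f : 'End(oct)) : oct_automorphism n w f ->
  exists g : spin_group n, rho (val g) = f.
Proof.
move=> fA; have [e eB] := exists_orthobasis nQ nN (leqnn 7).
have [|a [a2 aN aE]] := even_refls_orthobasis nQ (k := 6)
    (e' := fun i => automorphism_im f (e i)) eB _ (ltnSn 6).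
  by move=> i j _ _; apply: automorphism_polar.
have finj : injective f := bij_inj fA.1.
have Kf : cancel (f^-1)%VF f.
  by apply/(bij_can_sym fA.1)/lker0_lfunK/lker0P.
have [c hE] : exists c : R, ((f^-1) \o rho (gens a))%VF = c *: \1%VF.
  apply: (commute_six eB) => i x i6; apply: finj.
  rewrite (automorphism_lmul fA) !comp_lfunE /= !Kf (lmul_gens wG nw) // aE //.
  by rewrite -signr_odd (negPf a2) scale1r.
have raE x : rho (gens a) x = c *: f x.
  have := congr1 (fun h : 'End(oct) => f (h x)) hE.
  by rewrite comp_lfunE Kf scale_lfunE id_lfunE linearZ.
have c2 : \prod_(v <- a) n v = c ^+ 2.
  have := oct_norm_gens wG nw a oct_one.
  rewrite raE automorphism_one // (oct_normZ nw).
  by rewrite /oct_norm /= [n 0]nQ.2 polar0r // expr1n addr0 !mulr1.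
have cN : c != 0.
  by rewrite -sqrf_eq0 -c2 prodf_seq_neq0.
have e0N : n (e 0%N) != 0 by apply: eB.1.
(* Division by [c] is performed by two extra vectors: [e 0] times [t *: e 0] is the scalar
   [- t * n (e 0) = c^-1], and their norms multiply to [c^-2], which compensates [c2]. *)
pose t := - (c * n (e 0%N))^-1.
pose a' := [:: e 0%N, t *: e 0%N & a].
have gS : spin n (gens a').
  apply: spin_gens; first by rewrite /= negbK.
  rewrite !big_cons c2 [n (t *: _)]nQ.2 polarZl // polarZr // -nQ.2 /t.
  by field; rewrite cN e0N.
have [g gE] := spin_group_lift gS; exists g; rewrite gE; apply/lfunP => x.
rewrite !big_cons !(spin_repM wG nw) !comp_lfunE raE linearZ /=.
rewrite !(spin_rep_gen wG nw).
have LZ : L (t *: e 0%N) = t *: L (e 0%N).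
  by rewrite -!(spin_rep_gen wG nw) linearZ /= (spin_rep_scale wG nw).
rewrite LZ scale_lfunE !linearZ /= lmul_sqr !scalerA.
have -> : c * t * - n (e 0%N) = 1 by rewrite /t; field; rewrite cN e0N.
by rewrite scale1r.
Qed.

(** * The isomorphism from the isotropy group onto the automorphism group *)

Lemma isotropy_act_one (g : isotropy wG nw) :
  spin_act w (val g) oct_one = oct_one.
Proof. exact/eqP/(valP g). Qed.

Definition isotropy_to_aut (g : isotropy wG nw) : oct_aut n w :=
  exist _ (rho (val (val g)))
    (asboolT (isotropy_automorphism (isotropy_act_one g))).

Lemma isotropy_to_autM : {morph isotropy_to_aut : g h / (g * h)%g}.
Proof.
move=> g h; apply: val_inj.
exact: (spin_repM wG nw (val (val g)) (val (val h))).
Qed.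

HB.instance Definition _ := isMultiplicative.Build
  (isotropy wG nw) (oct_aut n w) isotropy_to_aut isotropy_to_autM.

Lemma isotropy_to_aut_bij : bijective isotropy_to_aut.
Proof.
rewrite -setTT_bijective; split=> //.
  move=> g h _ _ /(congr1 val) /= gh; apply: val_inj.
  apply/eqP; rewrite -(inj_eq (mulIg (val h)^-1%g)) mulgV; apply/eqP.
  apply: spin_rep_faithful.
  rewrite [rho _](spin_repM wG nw) gh -(spin_repM wG nw).
  rewrite -[_ * _]/(val (val h * (val h)^-1)%g) mulgV.
  exact: (spin_rep1 wG nw).
move=> f _; have [g gE] := automorphism_spin (asboolW (valP f)).
have g1 : fixes_one w g.
  by apply/eqP; rewrite /spin_act gE (automorphism_one (asboolW (valP f))).
by exists (exist _ g g1 : isotropy wG nw) => //; apply: val_inj.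
Qed.

End SpinAndAutomorphisms.

Theorem proposition6p2 (R : realType) (w : 'cV[R]_7 -> 'cV[R]_7 -> 'cV[R]_7 -> R)
    (n : 'cV[R]_7 -> R) (wG : generic w) (nw : related_norm w n) :
  [/\ forall (g : spin_group n) (x : R^o * 'cV[R]_7),
        oct_norm n x = 1 -> oct_norm n (spin_act w g x) = 1,
      forall x y : R^o * 'cV[R]_7, oct_norm n x = 1 -> oct_norm n y = 1 ->
        exists g : spin_group n, spin_act w g x = y
    & exists phi : {multiplicative isotropy wG nw -> oct_aut n w},
        bijective phi].
Proof.
split=> [g x x1|x y|]; first by rewrite (oct_norm_spin_act wG nw).
  exact: (spin_act_trans wG nw).
by exists (@isotropy_to_aut R w n wG nw); exact: isotropy_to_aut_bij.
Qed.
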